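(* Let $G$ be a finite subgroup of $GL_d(K)$ with $G\neq\langle 1\rangle$. Then the algebra $F_d({\mathfrak V})^G$ is not finitely generated (as a $K$-algebra) for any variety $\mathfrak V$ containing $\mathfrak L$.
   Context: $K$ is a field of characteristic $0$, $d\ge 2$ is an integer, and algebras are $K$-algebras, not necessarily associative or unital. A variety is the class of all algebras satisfying a given set of polynomial identities (elements of the absolutely free nonassociative algebra $K\{x_1,x_2,\ldots\}$). For a variety $\mathfrak V$, $F_d(\mathfrak V)$ is the relatively free algebra of $\mathfrak V$ of rank $d$, freely generated by $X_d=\{x_1,\ldots,x_d\}$, i.e. $K\{x_1,\ldots,x_d\}$ (without constant terms) modulo the polynomial identities of $\mathfrak V$ in $x_1,\ldots,x_d$. $\mathfrak L$ is the variety of algebras defined by the right-symmetric identity $(x_1,x_2,x_3)=(x_1,x_3,x_2)$, where $(x_1,x_2,x_3)=x_1(x_2x_3)-(x_1x_2)x_3$, together with $x_1(x_2x_3)=0$. $GL_d(K)$ acts canonically on the vector space $KX_d$ with basis $X_d$, and this action is extended to $F_d(\mathfrak V)$ by $g(f(x_1,\ldots,x_d))=f(g(x_1),\ldots,g(x_d))$. $F_d(\mathfrak V)^G$ is the subalgebra of elements fixed by all $g\in G$. *)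

(* Defs.v *)
From HB Require Import structures.
From mathcomp Require Import all_boot all_order all_algebra.
From mathcomp Require Import finmap boolp.
From mathcomp.multinomials Require Import monalg.

Set Implicit Arguments.
Unset Strict Implicit.
Unset Printing Implicit Defensive.

Import GRing.Theory.
Local Open Scope ring_scope.
Local Open Scope quotient_scope.

Reserved Notation "x *na y" (at level 40, left associativity).

(* Algebras over K, neither associative nor unital; the algebra hierarchy of
   ssralg always requires associativity and a unit. *)
HB.mixin Record Lmodule_isNAAlgebra (K : fieldType) A of GRing.Lmodule K A := {
  na_mul : A -> A -> A;
  na_mulDl_subproof : forall x y z, na_mul (x + y) z = na_mul x z + na_mul y z;
  na_mulDr_subproof : forall x y z, na_mul x (y + z) = na_mul x y + na_mul x z;
  na_mulZl_subproof : forall (c : K) x y, na_mul (c *: x) y = c *: na_mul x y;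
  na_mulZr_subproof : forall (c : K) x y, na_mul x (c *: y) = c *: na_mul x y
}.

#[short(type="naAlgType")]
HB.structure Definition NAAlgebra (K : fieldType) :=
  {A of GRing.Lmodule K A & Lmodule_isNAAlgebra K A}.

Notation "x *na y" := (na_mul x y) : ring_scope.

Section NAAlgebraTheory.
Variables (K : fieldType) (A : naAlgType K).
Implicit Types x y z : A.

Lemma na_mulDl x y z : (x + y) *na z = x *na z + y *na z.
Proof. exact: na_mulDl_subproof. Qed.

Lemma na_mulDr x y z : x *na (y + z) = x *na y + x *na z.
Proof. exact: na_mulDr_subproof. Qed.

Lemma na_mulZl (c : K) x y : (c *: x) *na y = c *: (x *na y).
Proof. exact: na_mulZl_subproof. Qed.

Lemma na_mulZr (c : K) x y : x *na (c *: y) = c *: (x *na y).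
Proof. exact: na_mulZr_subproof. Qed.

Lemma na_mul0l x : 0 *na x = 0.
Proof. by have := na_mulZl 0 0 x; rewrite !scale0r. Qed.

Lemma na_mul0r x : x *na 0 = 0.
Proof. by have := na_mulZr 0 x 0; rewrite !scale0r. Qed.

Lemma na_mulNl x y : (- x) *na y = - (x *na y).
Proof. by rewrite -scaleN1r na_mulZl scaleN1r. Qed.

Lemma na_mulNr x y : x *na (- y) = - (x *na y).
Proof. by rewrite -scaleN1r na_mulZr scaleN1r. Qed.

Lemma na_mul_suml (I : Type) (r : seq I) (F : I -> A) x :
  (\sum_(i <- r) F i) *na x = \sum_(i <- r) (F i *na x).
Proof.
elim: r => [|i r IHr]; first by rewrite !big_nil na_mul0l.
by rewrite !big_cons na_mulDl IHr.
Qed.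

Lemma na_mul_sumr (I : Type) (r : seq I) (F : I -> A) x :
  x *na (\sum_(i <- r) F i) = \sum_(i <- r) (x *na F i).
Proof.
elim: r => [|i r IHr]; first by rewrite !big_nil na_mul0r.
by rewrite !big_cons na_mulDr IHr.
Qed.

Definition associator x y z : A := x *na (y *na z) - (x *na y) *na z.

Definition subalgebra (B : A -> Prop) : Prop :=
  [/\ B 0, forall x y, B x -> B y -> B (x + y),
      forall (c : K) x, B x -> B (c *: x)
    & forall x y, B x -> B y -> B (x *na y)].

(* Membership in the subalgebra generated by s. *)
Definition generated (s : seq A) (x : A) : Prop :=
  forall B, subalgebra B -> (forall y, y \in s -> B y) -> B x.

(* The subalgebra B is finitely generated as an algebra. *)
Definition finitely_generated (B : A -> Prop) : Prop :=
  exists s : seq A, forall x, B x <-> generated s x.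

End NAAlgebraTheory.

(* The free magma on X: nonempty parenthesized words, i.e. the nonassociative
   monomials in X. *)
Inductive magma (X : Type) : Type :=
  | MVar of X
  | MMul of magma X & magma X.

Section MagmaChoice.
Variable X : choiceType.

Fixpoint magma_code (m : magma X) : GenTree.tree X :=
  match m with
  | MVar x => GenTree.Leaf x
  | MMul s t => GenTree.Node 0 [:: magma_code s; magma_code t]
  end.

Fixpoint magma_decode (t : GenTree.tree X) : option (magma X) :=
  match t with
  | GenTree.Leaf x => Some (MVar x)
  | GenTree.Node _ [:: t1; t2] =>
      match magma_decode t1, magma_decode t2 with
      | Some m1, Some m2 => Some (MMul m1 m2)
      | _, _ => None
      end
  | _ => None
  end.

Lemma magma_codeK : pcancel magma_code magma_decode.
Proof. by elim=> //= s -> t ->. Qed.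

HB.instance Definition _ := Choice.copy (magma X) (pcan_type magma_codeK).

End MagmaChoice.

(* The absolutely free algebra K{X} (without constant terms): the vector space
   with basis the free magma on X, with bilinearly extended product. *)
Definition freeNA (K : fieldType) (X : choiceType) : Type :=
  {malg K[magma X]}.

HB.instance Definition _ (K : fieldType) (X : choiceType) :=
  GRing.Zmodule.copy (freeNA K X) {malg K[magma X]}.

(* The scaling of {malg K[magma X]}, locked because unfolding it makes
   unification extremely slow. *)
HB.lock Definition fr_scale (K : fieldType) (X : choiceType) (c : K)
    (f : freeNA K X) : freeNA K X :=
  c *: (f : {malg K[magma X]}).

Section FreeScale.
Variables (K : fieldType) (X : choiceType).
Local Notation F := (freeNA K X).

Lemma fr_scaleE c (f : F) : fr_scale c f = c *: (f : {malg K[magma X]}).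
Proof. by rewrite fr_scale.unlock. Qed.

Lemma fr_scaleA c1 c2 (f : F) :
  fr_scale c1 (fr_scale c2 f) = fr_scale (c1 * c2) f.
Proof. by rewrite !fr_scaleE; exact: scalerA. Qed.

Lemma fr_scale1 : left_id 1 (@fr_scale K X).
Proof. by move=> f; rewrite fr_scaleE; exact: scale1r. Qed.

Lemma fr_scaleDr : right_distributive (@fr_scale K X) +%R.
Proof. by move=> c f g; rewrite !fr_scaleE; exact: scalerDr. Qed.

Lemma fr_scaleDl (f : F) : {morph (@fr_scale K X)^~ f : c1 c2 / c1 + c2}.
Proof. by move=> c1 c2; rewrite !fr_scaleE; exact: scalerDl. Qed.

HB.instance Definition _ := GRing.Zmodule_isLmodule.Build K F
  fr_scaleA fr_scale1 fr_scaleDr fr_scaleDl.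

Lemma fr_coeffD (f g : F) m : (f + g)@_m = f@_m + g@_m.
Proof. exact: mcoeffD. Qed.

Lemma fr_coeffZ c (f : F) m : (c *: f)@_m = c * f@_m.
Proof.
rewrite -[LHS]/((fr_scale c f)@_m) fr_scaleE; exact: mcoeffZ.
Qed.

Lemma fr_suppZ c (f : F) : (msupp (c *: f) `<=` msupp f)%fset.
Proof.
rewrite -[msupp (c *: f)]/(msupp (fr_scale c f)) fr_scaleE; exact: msuppZ_le.
Qed.

End FreeScale.

(* Linear extension of an arbitrary function on the basis. *)
HB.lock Definition linext (K : fieldType) (X : choiceType) (V : lmodType K)
    (h : magma X -> V) (p : freeNA K X) : V :=
  \sum_(m <- msupp p) p@_m *: h m.

HB.lock Definition mon (K : fieldType) (X : choiceType) (m : magma X) :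
    freeNA K X :=
  << 1 *g m >>.

Section FreeAlgebra.
Variables (K : fieldType) (X : choiceType).
Local Notation F := (freeNA K X).
Local Notation mon := (@mon K X).

Lemma linextE (V : lmodType K) (h : magma X -> V) (p : F) :
  linext h p = \sum_(m <- msupp p) p@_m *: h m.
Proof. by rewrite linext.unlock. Qed.

Lemma linextw (V : lmodType K) (h : magma X -> V) (p : F)
    (D : {fset magma X}) : (msupp p `<=` D)%fset ->
  linext h p = \sum_(m <- D) p@_m *: h m.
Proof.
move=> sD; rewrite linextE; apply: big_fset_incl => // m _ /mcoeff_outdom ->.
by rewrite scale0r.
Qed.

Lemma linextD V h : {morph @linext K X V h : p q / p + q}.
Proof.
move=> p q; pose D := (msupp p `|` msupp q)%fset.
rewrite (linextw h (msuppD_le p q)) (linextw (D := D) h (fsubsetUl _ _)).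
rewrite (linextw (D := D) h (fsubsetUr _ _)) -big_split /=.
by apply: eq_bigr => m _; rewrite fr_coeffD scalerDl.
Qed.

Lemma linextZ V h c p : @linext K X V h (c *: p) = c *: linext h p.
Proof.
rewrite (linextw h (fr_suppZ c p)) linextE scaler_sumr.
by apply: eq_bigr => m _; rewrite fr_coeffZ scalerA.
Qed.

Lemma linext_is_linear V h : linear (@linext K X V h).
Proof. by move=> c p q; rewrite linextD linextZ. Qed.

HB.instance Definition _ (V : lmodType K) (h : magma X -> V) :=
  GRing.isLinear.Build K F V *:%R (@linext K X V h) (@linext_is_linear V h).

Definition var (x : X) : F := mon (MVar x).

Lemma linext_mon V h m : @linext K X V h (mon m) = h m.
Proof.
by rewrite mon.unlock (linextw h msuppU_le) big_seq_fset1 mcoeffUU scale1r.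
Qed.

Lemma coeff_mon m k : (mon m)@_k = (m == k)%:R.
Proof. by rewrite mon.unlock; exact: mcoeffU. Qed.

Lemma mon_expand (p : F) : p = \sum_(m <- msupp p) p@_m *: mon m.
Proof.
rewrite {1}[p]monalgE; apply: eq_bigr => m _; apply/malgP => k.
by rewrite mcoeffU (fr_coeffZ p@_m (mon m) k) coeff_mon mulr_natr.
Qed.

Lemma mon_ind (P : F -> Prop) :
    P 0 -> (forall c m p, P p -> P (c *: mon m + p)) -> forall p, P p.
Proof.
move=> P0 PD p; rewrite [p]mon_expand; elim: (enum_fset _) => [|m r IHr].
  by rewrite big_nil.
by rewrite big_cons; apply: PD.
Qed.

Definition fr_mul (p q : F) : F :=
  linext (fun s => linext (fun t => mon (MMul s t)) q) p.

Lemma fr_mulDl p q r : fr_mul (p + q) r = fr_mul p r + fr_mul q r.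
Proof. exact: linextD. Qed.

Lemma fr_mulDr p q r : fr_mul p (q + r) = fr_mul p q + fr_mul p r.
Proof.
rewrite /fr_mul !linextE -big_split /=; apply: eq_bigr => s _.
by rewrite -scalerDr -linextD.
Qed.

Lemma fr_mulZl (c : K) p q : fr_mul (c *: p) q = c *: fr_mul p q.
Proof. exact: linextZ. Qed.

Lemma fr_mulZr (c : K) p q : fr_mul p (c *: q) = c *: fr_mul p q.
Proof.
rewrite /fr_mul !linextE scaler_sumr; apply: eq_bigr => s _.
by rewrite linextZ !scalerA mulrC.
Qed.

HB.instance Definition _ := Lmodule_isNAAlgebra.Build K F
  fr_mulDl fr_mulDr fr_mulZl fr_mulZr.

Lemma mon_mul s t : mon s *na mon t = mon (MMul s t).
Proof. by rewrite /na_mul /= /fr_mul !linext_mon. Qed.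

End FreeAlgebra.

Section Evaluation.
Variables (K : fieldType) (X : choiceType) (A : naAlgType K).

Fixpoint eval_mon (a : X -> A) (m : magma X) : A :=
  match m with
  | MVar x => a x
  | MMul s t => eval_mon a s *na eval_mon a t
  end.

(* f(a_x : x in X) *)
Definition eval (a : X -> A) (f : freeNA K X) : A := linext (eval_mon a) f.

HB.instance Definition _ a := GRing.Linear.copy (eval a) (linext (eval_mon a)).

Lemma eval_mon_free a m : eval a (mon K m) = eval_mon a m.
Proof. exact: linext_mon. Qed.

Lemma eval_var a x : eval a (var K x) = a x.
Proof. exact: eval_mon_free. Qed.

Lemma eval0 a : eval a 0 = 0. Proof. exact: linear0. Qed.

Lemma evalD a f g : eval a (f + g) = eval a f + eval a g.
Proof. exact: linearD. Qed.

Lemma evalZ a c f : eval a (c *: f) = c *: eval a f.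
Proof. exact: linextZ. Qed.

Lemma evalB a f g : eval a (f - g) = eval a f - eval a g.
Proof. exact: linearB. Qed.

Lemma evalM a f g : eval a (f *na g) = eval a f *na eval a g.
Proof.
elim/mon_ind: f => [|c s f IHf].
  by rewrite (na_mul0l g) !eval0 (na_mul0l (eval a g)).
rewrite na_mulDl !evalD IHf na_mulDl; congr (_ + _).
rewrite na_mulZl !evalZ na_mulZl; congr (_ *: _) => {c f IHf}.
elim/mon_ind: g => [|c t g IHg].
  by rewrite (na_mul0r (mon K s)) !eval0 (na_mul0r (eval a _)).
rewrite na_mulDr !evalD IHg na_mulDr; congr (_ + _).
by rewrite na_mulZr !evalZ na_mulZr mon_mul !eval_mon_free.
Qed.

End Evaluation.

Lemma eval_morph (K : fieldType) (X : choiceType) (A B : naAlgType K)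
    (h : {linear A -> B}) (a : X -> A) f :
  {morph h : x y / x *na y} -> h (eval a f) = eval (h \o a) f.
Proof.
move=> hM; elim/mon_ind: f => [|c m f IHf]; first by rewrite !eval0 linear0.
rewrite !evalD !evalZ linearD linearZ /= IHf !eval_mon_free; congr (_ *: _ + _).
by elim: m => //= s <- t <-; rewrite hM.
Qed.

Section Varieties.
Variable K : fieldType.

Definition is_identity (X : choiceType) (A : naAlgType K) (f : freeNA K X) :=
  forall a : X -> A, eval a f = 0.

(* The variables x_1, x_2, ... of polynomial identities are indexed by nat,
   starting from 0. *)
Definition variety_of (S : freeNA K nat -> Prop) (A : naAlgType K) : Prop :=
  forall f, S f -> is_identity A f.

Definition is_variety (V : naAlgType K -> Prop) : Prop :=
  exists S, forall A, V A <-> variety_of S A.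

Definition sub_variety (V W : naAlgType K -> Prop) : Prop :=
  forall A, V A -> W A.

Definition right_symmetric_identity : freeNA K nat :=
  associator (var K 0%N) (var K 1%N) (var K 2%N) -
  associator (var K 0%N) (var K 2%N) (var K 1%N).

Definition nilpotent_identity : freeNA K nat :=
  var K 0%N *na (var K 1%N *na var K 2%N).

Definition variety_L : naAlgType K -> Prop :=
  variety_of (fun f => f = right_symmetric_identity \/
                       f = nilpotent_identity).

End Varieties.

Arguments variety_L : clear implicits.

Section RelativelyFree.
Variables (K : fieldType) (V : naAlgType K -> Prop) (X : choiceType).

Definition identities : {pred freeNA K X} :=
  fun f => `[< forall A, V A -> is_identity A f >].

Lemma identitiesP f :
  reflect (forall A, V A -> is_identity A f) (f \in identities).
Proof. exact: asboolP. Qed.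

Lemma identities_zmod_closed : zmod_closed identities.
Proof.
split=> [|f g /identitiesP f0 /identitiesP g0]; apply/identitiesP => A VA a.
  exact: eval0.
by rewrite evalB f0 // g0 // subr0.
Qed.

HB.instance Definition _ :=
  GRing.isZmodClosed.Build (freeNA K X) identities identities_zmod_closed.

(* F_X(V) = K{X} / (identities of V in the variables X) *)
Definition relfree : Type := Quotient.quot identities.

HB.instance Definition _ := GRing.Zmodule.on relfree.
HB.instance Definition _ := Quotient.on relfree.

Definition rf_pi (f : freeNA K X) : relfree := \pi_relfree f.

Lemma rf_piP f g : reflect (rf_pi f = rf_pi g) (f - g \in identities).
Proof.
rewrite -[f - g \in _]/(Quotient.equiv identities f g) Quotient.equivE.
rewrite Quotient.idealrBE; exact: eqP.
Qed.

Lemma rf_reprK u : rf_pi (repr u) = u. Proof. exact: reprK. Qed.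

Lemma rf_repr_pi f : repr (rf_pi f) - f \in identities.
Proof. by apply/rf_piP; rewrite rf_reprK. Qed.

Lemma rf_piD f g : rf_pi (f + g) = rf_pi f + rf_pi g.
Proof. exact: (Quotient.pi_add identities f g). Qed.

Lemma identitiesZ c f : f \in identities -> c *: f \in identities.
Proof.
move=> /identitiesP f0; apply/identitiesP => A VA a.
by rewrite evalZ f0 // scaler0.
Qed.

Lemma identitiesMl f g : f \in identities -> f *na g \in identities.
Proof.
move=> /identitiesP f0; apply/identitiesP => A VA a.
by rewrite evalM f0 // na_mul0l.
Qed.

Lemma identitiesMr f g : g \in identities -> f *na g \in identities.
Proof.
move=> /identitiesP g0; apply/identitiesP => A VA a.
by rewrite evalM g0 // na_mul0r.
Qed.

Definition rf_scale (c : K) (u : relfree) : relfree := rf_pi (c *: repr u).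
Definition rf_mul (u v : relfree) : relfree := rf_pi (repr u *na repr v).

Lemma rf_scale_pi c f : rf_scale c (rf_pi f) = rf_pi (c *: f).
Proof.
by apply/rf_piP; rewrite -scalerBr; apply: identitiesZ; exact: rf_repr_pi.
Qed.

Lemma rf_mul_pi f g : rf_mul (rf_pi f) (rf_pi g) = rf_pi (f *na g).
Proof.
apply/rf_piP; set f' := repr _; set g' := repr _.
have -> : f' *na g' - f *na g = (f' - f) *na g' + f *na (g' - g).
  by rewrite na_mulDl na_mulDr na_mulNl na_mulNr addrA subrK.
apply: rpredD; [apply: identitiesMl | apply: identitiesMr];
  exact: rf_repr_pi.
Qed.

Lemma rf_scaleA c1 c2 u : rf_scale c1 (rf_scale c2 u) = rf_scale (c1 * c2) u.
Proof. by rewrite -(rf_reprK u) !rf_scale_pi scalerA. Qed.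

Lemma rf_scale1 : left_id 1 rf_scale.
Proof. by move=> u; rewrite -(rf_reprK u) !rf_scale_pi scale1r. Qed.

Lemma rf_scaleDr : right_distributive rf_scale +%R.
Proof.
move=> c u v; rewrite -(rf_reprK u) -(rf_reprK v).
by rewrite -rf_piD !rf_scale_pi scalerDr rf_piD.
Qed.

Lemma rf_scaleDl u : {morph rf_scale^~ u : c1 c2 / c1 + c2}.
Proof.
by move=> c1 c2; rewrite -(rf_reprK u) !rf_scale_pi scalerDl rf_piD.
Qed.

HB.instance Definition _ := GRing.Zmodule_isLmodule.Build K relfree
  rf_scaleA rf_scale1 rf_scaleDr rf_scaleDl.

Lemma rf_pi_is_linear : linear rf_pi.
Proof. by move=> c f g; rewrite rf_piD -rf_scale_pi. Qed.

Lemma rf_mulDl u v w : rf_mul (u + v) w = rf_mul u w + rf_mul v w.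
Proof.
rewrite -(rf_reprK u) -(rf_reprK v) -(rf_reprK w).
by rewrite -rf_piD !rf_mul_pi na_mulDl rf_piD.
Qed.

Lemma rf_mulDr u v w : rf_mul u (v + w) = rf_mul u v + rf_mul u w.
Proof.
rewrite -(rf_reprK u) -(rf_reprK v) -(rf_reprK w).
by rewrite -rf_piD !rf_mul_pi na_mulDr rf_piD.
Qed.

Lemma rf_mulZl (c : K) u v : rf_mul (c *: u) v = c *: rf_mul u v.
Proof.
rewrite -(rf_reprK u) -(rf_reprK v).
by rewrite /GRing.scale /= rf_scale_pi !rf_mul_pi rf_scale_pi na_mulZl.
Qed.

Lemma rf_mulZr (c : K) u v : rf_mul u (c *: v) = c *: rf_mul u v.
Proof.
rewrite -(rf_reprK u) -(rf_reprK v).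
by rewrite /GRing.scale /= rf_scale_pi !rf_mul_pi rf_scale_pi na_mulZr.
Qed.

HB.instance Definition _ := Lmodule_isNAAlgebra.Build K relfree
  rf_mulDl rf_mulDr rf_mulZl rf_mulZr.

HB.instance Definition _ :=
  GRing.isLinear.Build K (freeNA K X) relfree *:%R rf_pi rf_pi_is_linear.

Lemma rf_piM f g : rf_pi (f *na g) = rf_pi f *na rf_pi g.
Proof. exact: esym (rf_mul_pi f g). Qed.

Definition rf_gen (x : X) : relfree := rf_pi (var K x).

End RelativelyFree.

Arguments rf_pi {K} V {X} f.
Arguments rf_gen {K} V {X} x.

Lemma eval_eval (K : fieldType) (X Y : choiceType) (A : naAlgType K)
    (a : Y -> A) (b : X -> freeNA K Y) f :
  eval a (eval b f) = eval (eval a \o b) f.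
Proof. by apply: (eval_morph (h := eval a)) => p q; exact: evalM. Qed.

Lemma eval_pi (K : fieldType) V (X Y : choiceType) (b : X -> freeNA K Y) f :
  rf_pi V (eval b f) = eval (rf_pi V \o b) f.
Proof. by apply: (eval_morph (h := rf_pi V)) => p q; exact: rf_piM. Qed.

Lemma eval_identities (K : fieldType) (V : naAlgType K -> Prop)
    (X Y : choiceType) (f : freeNA K X) (a : X -> relfree V Y) :
  f \in @identities K V X -> eval a f = 0.
Proof.
move=> /identitiesP f0; pose b x : freeNA K Y := repr (a x).
have -> : a = rf_pi V \o b by apply: funext => x; rewrite /= rf_reprK.
rewrite -eval_pi -[RHS](linear0 (rf_pi V)); apply/rf_piP; rewrite subr0.
by apply/identitiesP => A VA c; rewrite eval_eval f0.
Qed.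

Lemma relfree_variety (K : fieldType) (V : naAlgType K -> Prop)
    (X : choiceType) : is_variety V -> V (relfree V X).
Proof.
case=> S VS; apply/VS => f Sf a; apply: eval_identities.
by apply/identitiesP => A /VS; exact.
Qed.

Section Action.
Variables (K : fieldType) (V : naAlgType K -> Prop) (d : nat).
Local Notation F := (relfree V 'I_d).

(* g(x_j) = \sum_i g_ij x_i, the action of GL_d(K) on the span of x_1..x_d. *)
Definition gl_gen (g : 'M[K]_d) (j : 'I_d) : F :=
  \sum_(i < d) g i j *: rf_gen V i.

(* g(f(x_1, ..., x_d)) = f(g(x_1), ..., g(x_d)); by gl_act_pi this does not
   depend on the polynomial f representing u. *)
Definition gl_act (g : 'M[K]_d) (u : F) : F := eval (gl_gen g) (repr u).

Lemma gl_act_pi g f : gl_act g (rf_pi V f) = eval (gl_gen g) f.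
Proof.
apply/eqP; rewrite -subr_eq0 /gl_act -evalB; apply/eqP.
by apply: eval_identities; exact: rf_repr_pi.
Qed.

Lemma gl_act_is_linear g : linear (gl_act g).
Proof.
move=> c u v; rewrite -[u]rf_reprK -[v]rf_reprK -linearP /= !gl_act_pi.
by rewrite evalD evalZ.
Qed.

HB.instance Definition _ g :=
  GRing.isLinear.Build K F F *:%R (gl_act g) (gl_act_is_linear g).

Lemma gl_actM g u v : gl_act g (u *na v) = gl_act g u *na gl_act g v.
Proof. by rewrite -[u]rf_reprK -[v]rf_reprK -rf_piM !gl_act_pi evalM. Qed.

Lemma gl_act_gen g j : gl_act g (rf_gen V j) = gl_gen g j.
Proof. by rewrite gl_act_pi eval_var. Qed.

Lemma eval_rf_gen f : eval (@rf_gen K V 'I_d) f = rf_pi V f.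
Proof.
have -> : @rf_gen K V 'I_d = rf_pi V \o @var K 'I_d by [].
rewrite -eval_pi; congr (rf_pi V _).
elim/mon_ind: f => [|c m f IHf]; first exact: eval0.
rewrite evalD IHf evalZ eval_mon_free; congr (_ *: _ + _).
by elim: m => //= s -> t ->; rewrite mon_mul.
Qed.

Lemma gl_act1 u : gl_act 1%:M u = u.
Proof.
have E : gl_gen 1%:M = @rf_gen K V 'I_d.
  apply: funext => j; rewrite /gl_gen (bigD1 j) //= mxE eqxx scale1r.
  by rewrite big1 ?addr0 // => i /negPf ij; rewrite mxE ij scale0r.
by rewrite /gl_act E eval_rf_gen rf_reprK.
Qed.

Lemma gl_act_comp g h u : gl_act (g *m h) u = gl_act g (gl_act h u).
Proof.
have -> : gl_act g (gl_act h u) = eval (gl_act g \o gl_gen h) (repr u).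
  by apply: (eval_morph (h := gl_act g)); exact: gl_actM.
congr (eval _ _); apply: funext => j; rewrite /= {2}/gl_gen linear_sum /=.
under [RHS]eq_bigr => k _ do
  rewrite linearZ /= gl_act_gen /gl_gen scaler_sumr.
rewrite exchange_big /=; apply: eq_bigr => i _.
rewrite mxE scaler_suml; apply: eq_bigr => k _.
by rewrite scalerA mulrC.
Qed.

(* GL_d(K) is the group of invertible matrices in 'M[K]_d. *)
Definition finite_subgroup_GL (G : {fset 'M[K]_d}) : Prop :=
  [/\ {in G, forall g, g \in unitmx}, 1%:M \in G,
      {in G &, forall g h, g *m h \in G}
    & {in G, forall g, invmx g \in G}].

(* The algebra of invariants F_d(V)^G. *)
Definition invariants (G : {fset 'M[K]_d}) (u : F) : Prop :=
  {in G, forall g, gl_act g u = u}.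

Lemma invariants_subalgebra G : subalgebra (invariants G).
Proof.
split=> [g _|u v iu iv g gG|c u iu g gG|u v iu iv g gG].
- exact: linear0.
- by rewrite linearD /= iu // iv.
- by rewrite linearZ /= iu.
- by rewrite gl_actM iu // iv.
Qed.

End Action.

(* Main.v *)
Require Import Defs.
From HB Require Import structures.
From mathcomp Require Import all_boot all_order all_algebra.
From mathcomp Require Import finmap.

(** The infinitely many generators that the invariants need are detected by
homomorphisms to one small algebra. On [K[t]] the product [f * g = g(0) t f]
satisfies both identities of [variety_L]: a product has zero constant term, so
that multiplying by it on the right gives [0], and [(f * g) * h = g(0) h(0) t^2
f] is symmetric in [g] and [h]. This algebra therefore lies in [V], and every
row vector [xi] gives a homomorphism [spec xi] from the relatively free algebra
to it, sending [x_j] to the constant [xi_j]. (In the free algebra of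
[variety_L], which is [KX (x) K[X]], the first factor is evaluated at the point
[xi] and the second along the line of points [t xi].)

Since [G] is nontrivial, some [g0 - 1] with [g0] in [G] has a nonzero entry
[(i, j)]; let [xi] be row [i] of [g0 - 1]. The constant term of [spec xi u]
depends only on the linear part of [u] and is linear in [xi], so that it
vanishes on every [u] fixed by [g0] ([coef0_spec_fixed]). Hence [spec xi] maps
every product of two invariants to [0]. If finitely many invariants generated
all of them, the images of all invariants would then lie in the span of
finitely many polynomials and have bounded degree ([size_spec_bounded]).

On the other hand, summing the orbit of the left-normed power
[(..(x_j x_j)..) x_j] with [n + 1] factors gives an invariant whose image is
[(\sum_g (xi g)_j ^ (n + 1)) t ^ n] ([spec_orbit_sum]). Bounded degree forces
these power sums to vanish for all large [n], and in characteristic [0] this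
forces every [(xi g)_j] to be [0] ([psum_eq0]), including [xi_j] itself, which
is the nonzero entry chosen at the start. *)

Set Implicit Arguments.
Unset Strict Implicit.
Unset Printing Implicit Defensive.

Import GRing.Theory.
Local Open Scope ring_scope.

(** If some [F i] is nonzero, a polynomial divisible by ['X^(N.+1)] can vanish
at every value of [F] except [F i]. Its sum over [s] is a combination of the
vanishing power sums, but also its value at [F i] times the multiplicity of
[F i], which is nonzero in characteristic [0]. *)
Lemma psum_eq0 (K : fieldType) (charK : [pchar K] =i pred0) (N : nat)
    (I : eqType) (s : seq I) (F : I -> K) :
  (forall n, (N <= n)%N -> \sum_(i <- s) F i ^+ n.+1 = 0) ->
  {in s, forall i, F i = 0}.
Proof.
move=> psum0 i si; apply/eqP; apply: contraT => Fi_neq0.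
pose cs := [seq c <- undup (map F s) | c != F i].
pose p : {poly K} := 'X^(N.+1) * \prod_(c <- cs) ('X - c%:P).
have sum0 : \sum_(j <- s) p.[F j] = 0.
  under eq_bigr do rewrite horner_coef.
  rewrite exchange_big big1 //= => k _; rewrite -mulr_sumr.
  case: k => [[|k] /= _]; first by rewrite coefXnM /= mul0r.
  have [Nk|kN] := leqP N k; first by rewrite psum0 ?mulr0.
  by rewrite coefXnM ltnS kN mul0r.
have pFi : p.[F i] != 0.
  rewrite hornerM hornerXn mulf_neq0 ?expf_neq0 // horner_prod.
  rewrite prodf_seq_neq0; apply/allP => c; rewrite mem_filter => /andP[cFi _] /=.
  by rewrite hornerXsubC subr_eq0 eq_sym.
have pF j : j \in s -> p.[F j] = p.[F i] *+ (F j == F i).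
  move=> sj; have [-> //|FjFi] := eqVneq (F j) (F i).
  apply/eqP; rewrite hornerM mulf_eq0 horner_prod prodf_seq_eq0; apply/orP; right.
  apply/hasP; exists (F j) => /=; last by rewrite hornerXsubC subrr.
  by rewrite mem_filter FjFi mem_undup map_f.
move: sum0; rewrite (eq_big_seq _ pF) sumrMnr => /eqP.
rewrite -mulr_natr mulf_eq0 (negPf pFi) /= ((pcharf0P K).1 charK).
rewrite sum_nat_seq_eq0 => /allP/(_ i si).
by rewrite eqxx.
Qed.

(** The homomorphism out of the relatively free algebra given by its universal
property; it is independent of the chosen representative by [rf_eval_pi], as
soon as [A] lies in the variety. *)
Section UniversalProperty.
Variables (K : fieldType) (V : naAlgType K -> Prop) (X : choiceType).
Variables (A : naAlgType K) (VA : V A) (a : X -> A).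

Definition rf_eval (u : relfree V X) : A := eval a (repr u).

Lemma rf_eval_pi f : rf_eval (rf_pi V f) = eval a f.
Proof.
apply/eqP; rewrite -subr_eq0 /rf_eval -evalB.
by have /identitiesP-> := rf_repr_pi V f.
Qed.

Lemma rf_eval_is_linear : linear rf_eval.
Proof.
move=> c u v; rewrite -[u]rf_reprK -[v]rf_reprK -linearP !rf_eval_pi.
by rewrite evalD evalZ.
Qed.

Lemma rf_evalM u v : rf_eval (u *na v) = rf_eval u *na rf_eval v.
Proof. by rewrite -[u]rf_reprK -[v]rf_reprK -rf_piM !rf_eval_pi evalM. Qed.

Lemma rf_eval_gen x : rf_eval (rf_gen V x) = a x.
Proof. by rewrite rf_eval_pi eval_var. Qed.

Lemma rf_eval_eval (Y : choiceType) (b : Y -> relfree V X) (f : freeNA K Y) :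
  rf_eval (eval b f) = eval (rf_eval \o b) f.
Proof.
have -> : b = rf_pi V \o (fun y => repr (b y)).
  by apply: boolp.funext => y; rewrite /= rf_reprK.
rewrite -eval_pi rf_eval_pi eval_eval; congr (eval _ f).
by apply: boolp.funext => y; rewrite /= rf_eval_pi.
Qed.

End UniversalProperty.

(** An alias of [{poly K}], so that the product below does not compete with the
product of polynomials. *)
Definition shiftAlg (K : fieldType) : Type := {poly K}.

Section ShiftAlgebra.
Variable K : fieldType.
HB.instance Definition _ := GRing.Lmodule.copy (shiftAlg K) {poly K}.

Definition shift_mul (f g : {poly K}) : {poly K} := g`_0 *: ('X * f).

Lemma shift_mulDl f g h : shift_mul (f + g) h = shift_mul f h + shift_mul g h.
Proof. by rewrite /shift_mul mulrDr scalerDr. Qed.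
Lemma shift_mulDr f g h : shift_mul f (g + h) = shift_mul f g + shift_mul f h.
Proof. by rewrite /shift_mul coefD scalerDl. Qed.
Lemma shift_mulZl c f g : shift_mul (c *: f) g = c *: shift_mul f g.
Proof. by rewrite /shift_mul -scalerAr !scalerA mulrC. Qed.
Lemma shift_mulZr c f g : shift_mul f (c *: g) = c *: shift_mul f g.
Proof. by rewrite /shift_mul coefZ scalerA. Qed.

HB.instance Definition _ := Lmodule_isNAAlgebra.Build K (shiftAlg K)
  shift_mulDl shift_mulDr shift_mulZl shift_mulZr.

Lemma shiftAlg_mulE (f g : shiftAlg K) :
  f *na g = (g : {poly K})`_0 *: ('X * (f : {poly K})) :> {poly K}.
Proof. by []. Qed.

Lemma coef0_shiftAlg_mul (f g : shiftAlg K) : (f *na g : {poly K})`_0 = 0.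
Proof. by rewrite shiftAlg_mulE coefZ coefXM mulr0. Qed.

Lemma variety_L_shiftAlg : variety_L K (shiftAlg K).
Proof.
have nil (f g h : shiftAlg K) : f *na (g *na h) = 0.
  by rewrite [LHS]shiftAlg_mulE coef0_shiftAlg_mul scale0r.
move=> _ [->|->] a; last by rewrite !evalM nil.
rewrite /right_symmetric_identity /associator !evalB !evalM !nil !sub0r.
rewrite !eval_var opprK addrC; apply/eqP; rewrite subr_eq0; apply/eqP.
by rewrite !shiftAlg_mulE -!scalerAr !scalerA mulrC.
Qed.

End ShiftAlgebra.

Lemma gl_orbit_sum_invariant (K : fieldType) (V : naAlgType K -> Prop) (d : nat)
    (G : {fset 'M[K]_d}) (u : relfree V 'I_d) :
  finite_subgroup_GL G -> invariants G (\sum_(g <- G) gl_act g u).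
Proof.
case=> Gunit _ GM GV h hG; rewrite linear_sum /=.
under eq_bigr do rewrite -gl_act_comp.
rewrite -[LHS](big_map (mulmx h) xpredT (fun g => gl_act g u)).
apply: perm_big; apply: uniq_perm => [||g].
- by rewrite map_inj_uniq ?fset_uniq //; apply: can_inj (mulKmx (Gunit h hG)).
- exact: fset_uniq.
apply/mapP/idP => [[k kG ->]|gG]; first exact: GM.
by exists (invmx h *m g); rewrite ?mulKVmx ?GM ?GV ?Gunit.
Qed.

(** The left-normed power, with [n.+1] factors; right-normed ones vanish in
[variety_L] from degree 3 on. *)
Definition rf_pow (K : fieldType) (V : naAlgType K -> Prop) (d : nat)
    (j : 'I_d) (n : nat) : relfree V 'I_d :=
  iter n (fun w => w *na rf_gen V j) (rf_gen V j).

Section Specialization.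
Variables (K : fieldType) (V : naAlgType K -> Prop) (d : nat).
Hypothesis L_sub_V : sub_variety (variety_L K) V.
Local Notation F := (relfree V 'I_d).
Implicit Types (xi : 'rV[K]_d) (u v : F).

Let VA : V (shiftAlg K) := L_sub_V (@variety_L_shiftAlg K).

Definition spec xi : F -> shiftAlg K :=
  rf_eval (fun i => (xi 0 i)%:P : shiftAlg K).

Lemma spec_is_linear xi : linear (spec xi).
Proof. exact: rf_eval_is_linear. Qed.

HB.instance Definition _ xi :=
  GRing.isLinear.Build K F (shiftAlg K) *:%R (spec xi) (spec_is_linear xi).

Lemma specM xi u v : spec xi (u *na v) = spec xi u *na spec xi v.
Proof. exact: rf_evalM. Qed.

Lemma spec_gen xi i : spec xi (rf_gen V i) = (xi 0 i)%:P.
Proof. exact: rf_eval_gen. Qed.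

(** Both sides are homomorphisms in [u], and [g] acts on the generators through
its columns, whence the product with [g] on the right of the row [xi]. *)
Lemma spec_gl_act xi g u : spec xi (gl_act g u) = spec (xi *m g) u.
Proof.
rewrite /spec /gl_act rf_eval_eval //; congr (eval _ _).
apply: boolp.funext => j; rewrite /= -/(spec xi _) /gl_gen linear_sum /=.
rewrite mxE rmorph_sum /=; apply: eq_bigr => i _.
by rewrite linearZ /= spec_gen -mul_polyC -polyCM mulrC.
Qed.

(** [spec] itself is not additive in its row vector: the coefficient of [t^n] has
degree [n.+1] in [xi]. Only the constant term, which sees the linear part of
[u] alone, is. *)
Lemma coef0_specB xi eta u :
  (spec (xi - eta) u : {poly K})`_0
  = (spec xi u : {poly K})`_0 - (spec eta u : {poly K})`_0.
Proof.
rewrite -[u]rf_reprK; elim/mon_ind: (repr u) => [|c m f IHf].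
  by rewrite !linear0 /= !coef0 subr0.
rewrite !linearP /= !coefD !coefZ IHf opprD addrACA; congr (_ + _).
rewrite -mulrBr; congr (_ * _); case: m => [i|s t].
  by rewrite !spec_gen !coefC /= !mxE.
by rewrite -mon_mul rf_piM !specM !coef0_shiftAlg_mul subr0.
Qed.

Lemma coef0_spec_fixed xi g u :
  gl_act g u = u -> (spec (xi *m g - xi) u : {poly K})`_0 = 0.
Proof. by move=> gu; rewrite coef0_specB -spec_gl_act gu subrr. Qed.

Lemma spec_pow xi j n :
  spec xi (rf_pow V j n) = xi 0 j ^+ n.+1 *: 'X^n.
Proof.
elim: n => [|n IHn] /=; first by rewrite spec_gen expr1 expr0 alg_polyC.
rewrite specM IHn spec_gen shiftAlg_mulE coefC /= -scalerAr scalerA -!exprS.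
by [].
Qed.

(** When constant terms vanish on invariants, the product of two invariants maps
to [0], so a bound for the degrees of the images of the generators is inherited
by the whole subalgebra. *)
Lemma size_spec_bounded (G : {fset 'M[K]_d}) xi :
    (forall u, invariants G u -> (spec xi u : {poly K})`_0 = 0) ->
    finitely_generated (invariants (V := V) G) ->
  exists N, forall u, invariants G u -> (size (spec xi u : {poly K}) <= N)%N.
Proof.
move=> xi0 [s gen_s]; exists (\max_(u <- s) size (spec xi u : {poly K})) => u.
set N := \max_(_ <- _) _ => /gen_s gu.
pose B v := invariants G v /\ (size (spec xi v : {poly K}) <= N)%N.
suff [] : B u by [].
apply: gu => [|v sv]; last first.
  split; last by rewrite /N (big_rem v) //= leq_maxl.
  by apply/gen_s => C _; apply.
have [I0 ID IZ IM] := invariants_subalgebra V G.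
split=> [|v w [iv sv] [iw sw]|c v [iv sv]|v w [iv _] [iw _]].
- split=> //; have -> : spec xi 0 = 0 :> {poly K} by exact: linear0.
  by rewrite size_poly0.
- split; first exact: ID.
  by rewrite linearD (leq_trans (size_polyD _ _)) // geq_max sv.
- split; first exact: IZ.
  by rewrite linearZ (leq_trans (size_scale_leq _ _)).
- split; first exact: IM.
  by rewrite specM shiftAlg_mulE xi0 // scale0r size_poly0.
Qed.

Lemma spec_orbit_sum (G : {fset 'M[K]_d}) xi j n :
  spec xi (\sum_(g <- G) gl_act g (rf_pow V j n))
  = (\sum_(g <- G) (xi *m g) 0 j ^+ n.+1) *: 'X^n.
Proof.
rewrite linear_sum scaler_suml; apply: eq_bigr => g _.
by rewrite /= spec_gl_act spec_pow.
Qed.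

End Specialization.

Theorem theorem3p2 (K : fieldType) (charK : [pchar K] =i pred0)
    (d : nat) (d_ge2 : (2 <= d)%N)
    (G : {fset 'M[K]_d}) (G_group : finite_subgroup_GL G)
    (G_nontrivial : G <> [fset 1%:M]%fset)
    (V : naAlgType K -> Prop) (V_variety : is_variety V)
    (L_sub_V : sub_variety (variety_L K) V) :
  ~ finitely_generated (invariants (V := V) G).
Proof.
move=> fgG; have [_ G1 _ _] := G_group.
have [g0 g0G [i [j g0ij]]] :
    exists2 g, g \in G & exists i j, (g - 1%:M) i j != 0.
  apply: boolp.contrapT => noG; apply: G_nontrivial; apply/fsetP => g.
  rewrite in_fset1; apply/idP/eqP => [gG|->//]; apply/matrixP => i j.
  apply/eqP; apply: boolp.contrapT => /negP gij; apply: noG; exists g => //.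
  by exists i, j; move: gij; rewrite -subr_eq0 !mxE.
pose xi : 'rV[K]_d := row i (g0 - 1%:M).
have xi0 u : invariants (V := V) G u -> (spec xi u : {poly K})`_0 = 0.
  move=> /(_ _ g0G); have -> : xi = delta_mx 0 i *m g0 - delta_mx 0 i.
    by rewrite /xi rowE mulmxBr mulmx1.
  exact: coef0_spec_fixed.
have [N bounded] := size_spec_bounded L_sub_V xi0 fgG.
have psum0 n : (N <= n)%N -> \sum_(g <- G) (xi *m g) 0 j ^+ n.+1 = 0.
  move=> Nn; have /bounded := gl_orbit_sum_invariant (rf_pow V j n) G_group.
  rewrite spec_orbit_sum // => /leq_sizeP/(_ n Nn).
  by rewrite coefZ coefXn eqxx mulr1.
have := psum_eq0 charK psum0 G1; rewrite mulmx1 mxE => /eqP.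
by rewrite (negPf g0ij).
Qed.
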